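(* Let $(X,M,\pi_1)$, $(Y,M,\pi_2)$ be bundles with metric fibers and $u:M\to M$ a map. Let $H:X\times Y\to X\times Y$ be a bundle correspondence over $u$ with generating bundle map $(F,G)$, and let $\varepsilon_1:M\to\mathbb R_+$. Assume: (i) $i=(i_X,i_Y):M\to X\times Y$ is a section such that for all $m\in M$ $$|i_X(u(m))-F_m(i_X(m),i_Y(u(m)))|\le \eta(u(m)),\qquad |i_Y(m)-G_m(i_X(m),i_Y(u(m)))|\le\eta(m),$$ where $\eta:M\to\mathbb R_+$ satisfies $\eta(u(m))\le\varepsilon(m)\eta(m)$ with $0\le\varepsilon(m)\le\varepsilon_1(m)$ for all $m\in M$; and one of the following two conditions holds: (ii) $H$ satisfies the (A$'$)$(\alpha,\lambda_u)$ (B)$(\beta;\beta',\lambda_s)$ condition, where $\alpha,\beta,\beta',\lambda_u,\lambda_s:M\to\mathbb R_+$, and (a) $\sup_m\alpha(m)\beta'(u(m))<1$, $\beta'(u(m))\le\beta(m)$ for all $m$, $\sup_m\{\alpha(m),\beta(m)\}<\infty$; (b) $\sup_m\dfrac{\lambda_u(m)\lambda_s(m)+\lambda_u(m)\varepsilon_1(m)}{1-\alpha(m)\beta'(u(m))}<1$; (ii)$'$ or $H$ satisfies the (A)$(\alpha;\alpha',\lambda_u)$ (B)$(\beta;\beta',\lambda_s)$ condition, where $\alpha,\beta,\alpha',\beta',\lambda_u,\lambda_s:M\to\mathbb R_+$, and (a)$'$ $\sup_m\alpha'(m)\beta'(u(m))<1$, $\alpha'(m)\le\alpha(u(m))$,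 $\beta'(u(m))\le\beta(m)$ for all $m$, $\sup_m\{\alpha(m),\beta(m)\}<\infty$; (b)$'$ $\sup_m\lambda_s(m)\lambda_u(m)<1$, $\sup_m\lambda_u(m)\varepsilon_1(m)<1$. Then there is a unique bundle map $f:X\to Y$ over $\mathrm{id}$ such that: (1) $\operatorname{Lip} f_m\le\beta'(m)$ and $|f_m(i_X(m))-i_Y(m)|\le K\eta(m)$ for all $m\in M$, for some constant $K\ge0$. (2) $\operatorname{Graph} f\subset H^{-1}\operatorname{Graph} f$; more precisely, $(x_m(x),f_{u(m)}(x_m(x)))\in H_m(x,f_m(x))$ for all $x\in X_m$, where $x_m(\cdot):X_m\to X_{u(m)}$ satisfies $\operatorname{Lip}x_m(\cdot)\le\lambda_s(m)$ and $|x_m(i_X(m))-i_X(u(m))|\le K_0\eta(u(m))$ for all $m\in M$ and some constant $K_0$. (3) $f$ does not depend on the choice of $\eta$: replacing $\eta$ by any $\eta':M\to\mathbb R_+$ such that $\eta'(u(m))\le\varepsilon'(m)\eta'(m)$, $\varepsilon'(m)\le\varepsilon_1(m)$ and $\eta(m)\le\eta'(m)$ for all $m\in M$ yields the same $f$.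
   Context: A bundle with metric fibers $(X,M,\pi)$ is a surjection $\pi:X\to M$ of sets such that every fiber $X_m=\pi^{-1}(m)$ is a complete metric space; all metrics are written $d(x,y)=|x-y|$. $X\times Y$ is the bundle over $M$ with fibers $X_m\times Y_m$. A section $i$ of $X\times Y$ has $i(m)=(i_X(m),i_Y(m))\in X_m\times Y_m$. A bundle map $f:X\to Y$ over $\mathrm{id}$ is a family of maps $f_m:X_m\to Y_m$, and $\operatorname{Graph}f=\bigcup_m\{m\}\times\operatorname{Graph}f_m$. A correspondence $H:A\to B$ is a nonempty subset $\operatorname{Graph}H\subset A\times B$; $H(a)=\{b:(a,b)\in\operatorname{Graph}H\}$; $A'\subset H^{-1}(B')$ means that for every $a\in A'$ there is $b\in B'$ with $b\in H(a)$. A correspondence $H:X_1\times Y_1\to X_2\times Y_2$ has generating map $(F,G)$ (written $H\sim(F,G)$), $F:X_1\times Y_2\to X_2$, $G:X_1\times Y_2\to Y_1$, if $(x_2,y_2)\in H(x_1,y_1)\iff y_1=G(x_1,y_2),\ x_2=F(x_1,y_2)$. A bundle correspondence over $u$ with generating bundle map $(F,G)$ is a family of correspondences $H_m\sim(F_m,G_m):X_m\times Y_m\to X_{u(m)}\times Y_{u(m)}$, $m\in M$. For $H\sim(F,G):X_1\times Y_1\to X_2\times Y_2$ and constants, conditions are required for all $(x_1,y_1)\times(x_2,y_2)$, $(x_1',y_1')\times(x_2',y_2')\in\operatorname{Graph}H$: (A)$(\alpha;\alpha',\lambda_u)$: if $|x_1-x_1'|\le\alpha|y_1-y_1'|$ then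 $|x_2-x_2'|\le\alpha'|y_2-y_2'|$ and $|y_1-y_1'|\le\lambda_u|y_2-y_2'|$. (B)$(\beta;\beta',\lambda_s)$: if $|y_2-y_2'|\le\beta|x_2-x_2'|$ then $|y_1-y_1'|\le\beta'|x_1-x_1'|$ and $|x_2-x_2'|\le\lambda_s|x_1-x_1'|$. (A$'$)$(\alpha,\lambda_u)$: $\sup_x\operatorname{Lip}F(x,\cdot)\le\alpha$ and $\sup_x\operatorname{Lip}G(x,\cdot)\le\lambda_u$. A bundle correspondence satisfies such a condition with functions $\alpha,\dots:M\to\mathbb R_+$ if each $H_m$ satisfies it with the values at $m$. *)

(* Defs.v *)
From HB Require Import structures.
From mathcomp Require Import all_boot all_order all_algebra.
From mathcomp Require Import all_classical all_reals all_analysis.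

Set Implicit Arguments.
Unset Strict Implicit.
Unset Printing Implicit Defensive.

Import Order.TTheory GRing.Theory Num.Theory.

Local Open Scope classical_set_scope.
Local Open Scope ring_scope.

(* The base point carried by [Complete] only says that the space is nonempty. *)
#[short(type="completeMetricType")]
HB.structure Definition CompleteMetric (R : numDomainType) :=
  {T of Complete T & Metric R T}.

(* A bundle with metric fibers over M is represented by the family of its
   fibers, X : M -> completeMetricType R.  Nonemptiness of the fibers is
   surjectivity of the projection; a section is a dependent function and a
   bundle map over id a family of maps between fibers. *)

(* The pairs x = x' contribute 0 / 0 = 0 to the supremum, so that Lip f = 0
   when S is a singleton. *)
Definition Lip (R : realType) (S T : metricType R) (f : S -> T) : \bar R :=
  ereal_sup [set r | exists x x' : S,
    r = (mdist (f x) (f x') / mdist x x')%:E].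

Definition esup (R : realType) (M : Type) (g : M -> R) : \bar R :=
  ereal_sup (range (fun m => (g m)%:E)).

Definition fgraph (A B : Type) (f : A -> B) : set (A * B) :=
  [set z | z.2 = f z.1].

Record correspondence (A B : Type) := Correspondence {
  corr_graph : set (A * B);
  corr_graph_nonempty : corr_graph !=set0
}.

Definition corr_image (A B : Type) (H : correspondence A B) (a : A) : set B :=
  [set b | corr_graph H (a, b)].

Definition corr_preimage (A B : Type) (H : correspondence A B) (B' : set B) :
    set A :=
  [set a | exists2 b, B' b & corr_image H a b].

Definition generating_map (X1 Y1 X2 Y2 : Type)
    (H : correspondence (X1 * Y1) (X2 * Y2))
    (F : X1 -> Y2 -> X2) (G : X1 -> Y2 -> Y1) : Prop :=
  forall x1 y1 x2 y2,
    corr_image H (x1, y1) (x2, y2) <-> y1 = G x1 y2 /\ x2 = F x1 y2.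

Definition condA (R : realType) (X1 Y1 X2 Y2 : metricType R)
    (H : correspondence (X1 * Y1) (X2 * Y2)) (a a' lu : R) : Prop :=
  forall (x1 x1' : X1) (y1 y1' : Y1) (x2 x2' : X2) (y2 y2' : Y2),
    corr_graph H ((x1, y1), (x2, y2)) ->
    corr_graph H ((x1', y1'), (x2', y2')) ->
    mdist x1 x1' <= a * mdist y1 y1' ->
    mdist x2 x2' <= a' * mdist y2 y2' /\ mdist y1 y1' <= lu * mdist y2 y2'.

Definition condB (R : realType) (X1 Y1 X2 Y2 : metricType R)
    (H : correspondence (X1 * Y1) (X2 * Y2)) (b b' ls : R) : Prop :=
  forall (x1 x1' : X1) (y1 y1' : Y1) (x2 x2' : X2) (y2 y2' : Y2),
    corr_graph H ((x1, y1), (x2, y2)) ->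
    corr_graph H ((x1', y1'), (x2', y2')) ->
    mdist y2 y2' <= b * mdist x2 x2' ->
    mdist y1 y1' <= b' * mdist x1 x1' /\ mdist x2 x2' <= ls * mdist x1 x1'.

Definition condA' (R : realType) (X1 Y1 X2 Y2 : metricType R)
    (F : X1 -> Y2 -> X2) (G : X1 -> Y2 -> Y1) (a lu : R) : Prop :=
  (ereal_sup (range (fun x => Lip (F x))) <= a%:E)%E /\
  (ereal_sup (range (fun x => Lip (G x))) <= lu%:E)%E.

Definition lipschitz_near_section (R : realType) (M : Type)
    (X Y : M -> completeMetricType R) (i : forall m, X m * Y m)
    (beta' eta : M -> R) (f : forall m, X m -> Y m) : Prop :=
  (forall m, (Lip (f m) <= (beta' m)%:E)%E) /\
  exists2 K : R, 0 <= K &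
    forall m, mdist (f m (i m).1) (i m).2 <= K * eta m.

Definition invariant_graph (R : realType) (M : Type)
    (X Y : M -> completeMetricType R) (u : M -> M)
    (H : forall m, correspondence (X m * Y m) (X (u m) * Y (u m)))
    (i : forall m, X m * Y m) (lambda_s eta : M -> R)
    (f : forall m, X m -> Y m) : Prop :=
  (forall m, fgraph (f m) `<=` corr_preimage (H m) (fgraph (f (u m)))) /\
  exists (xs : forall m, X m -> X (u m)) (K0 : R), forall m,
    [/\ forall x, corr_image (H m) (x, f m x) (xs m x, f (u m) (xs m x)),
        (Lip (xs m) <= (lambda_s m)%:E)%E
      & mdist (xs m (i m).1) (i (u m)).1 <= K0 * eta (u m)].

(* Main.v *)
(* The map f is the fixed point of the graph transform: given a family g of
   beta'-Lipschitz maps, solve x2 = F_m(x, g_(u m)(x2)) by contraction (the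
   Lipschitz constant alpha * beta' is < 1) and put x |-> G_m(x, g_(u m)(x2)).
   Condition (B) makes the new family beta'-Lipschitz again.

   Two transforms are compared along the orbit x, x2, ...: their distance after
   n steps is at most C0 times the product of n factors kappa times the
   distance of the original families at the end of the orbit.  Under (ii) one
   may take kappa = lambda_u / (1 - alpha * beta') and C0 = 1; under (ii)' one
   may take kappa = lambda_u, since the two orbits stay in the cones of (A) and
   the factor 1 / (1 - alpha' * beta') is lost only once.

   The distances are weighed by p * eta m + q * |x - i_X(m)|.  Along an orbit
   |x - i_X| is multiplied by lambda_s up to an error of order eta, and eta by
   eps1; as kappa * lambda_s and kappa * eps1 are bounded by theta < 1, the
   iterates of the constant family i_Y converge geometrically, and the same
   estimate gives uniqueness. *)

Require Import Defs.
From mathcomp Require Import all_boot all_order all_algebra.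
From mathcomp Require Import all_classical all_reals all_analysis.
From mathcomp Require Import ring lra.

Set Implicit Arguments.
Unset Strict Implicit.
Unset Printing Implicit Defensive.

Import Order.TTheory GRing.Theory Num.Theory.

Local Open Scope classical_set_scope.
Local Open Scope ring_scope.

(** * Geometric bounds, suprema, Lipschitz constants and completeness *)

Lemma geometric_lt (R : realType) (c r e : R) :
  0 <= r < 1 -> 0 < e -> exists n, c * r ^+ n < e.
Proof.
move=> /andP[r0 r1] e0.
have : (c * r ^+ n) @[n --> \oo] --> (0 : R^o).
  by apply: cvg_geometric; rewrite ger0_norm.
move=> /cvgrPdist_lt /(_ e e0) [n _ /(_ n (leqnn n))] /=.
by rewrite sub0r normrN => /ltr_normlW h; exists n.
Qed.

Lemma le_geometric (R : realType) (x y c r : R) :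
  0 <= r < 1 -> (forall n, x <= y + c * r ^+ n) -> x <= y.
Proof.
move=> rP h; apply/ler_addgt0Pr => e /(geometric_lt c rP)[n] hn.
by apply: le_trans (h n) _; rewrite lerD2l ltW.
Qed.

(** The maximum with 0 makes the bound nonnegative and stays below [e] because [0 < e]. The supremum
    is -oo only for empty [M], where 0 serves. *)
Lemma esup_bound (R : realType) (M : Type) (g : M -> R) (e : \bar R) :
  (esup g < e)%E -> (0 < e)%E ->
  exists s : R, [/\ 0 <= s, (s%:E < e)%E & forall m, g m <= s].
Proof.
rewrite /esup => ge e0.
have h m : ((g m)%:E <= ereal_sup (range (fun m => (g m)%:E)))%E.
  by apply: ereal_sup_ubound; exists m.
move: h ge; case: (ereal_sup _) => [s| |] h ge.
- exists (Num.max 0 s); split; first by rewrite le_max lexx.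
    by rewrite /Num.max; case: ifP.
  by move=> m; rewrite le_max; move: (h m); rewrite lee_fin => ->; rewrite orbT.
- by move: ge; rewrite ltNge leey.
- by exists 0; split => // m; have := h m; rewrite leeNy_eq.
Qed.

Lemma LipP (R : realType) (S T : metricType R) (f : S -> T) (k : R) : 0 <= k ->
  (Lip f <= k%:E)%E <-> forall x x', mdist (f x) (f x') <= k * mdist x x'.
Proof.
move=> k0; split => [fk x x'|fk].
  have [->|xx'] := eqVneq x x'; first by rewrite !mdistxx mulr0.
  rewrite -ler_pdivrMr ?mdist_gt0// -lee_fin; apply: le_trans fk.
  by apply: ereal_sup_ubound; exists x, x'.
apply: ge_ereal_sup => _ [x [x' ->]]; rewrite lee_fin.
have [->|xx'] := eqVneq x x'; first by rewrite !mdistxx mul0r.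
by rewrite ler_pdivrMr ?mdist_gt0.
Qed.

Lemma geometric_complete (R : realType) (T : completeMetricType R)
    (s : nat -> T) (c r : R) : 0 <= c -> 0 <= r < 1 ->
  (forall n, mdist (s n) (s n.+1) <= c * r ^+ n) ->
  exists l, forall n, mdist (s n) l <= c / (1 - r) * r ^+ n.
Proof.
move=> c0 rP sP; have /andP[r0 r1] := rP.
have r1' : 0 < 1 - r by rewrite subr_gt0.
have sn n k : mdist (s n) (s (n + k)%N) <= c / (1 - r) * r ^+ n.
  (* The exact partial sum of the geometric series lets the induction on [k] close; its factor
     [1 - r ^+ k] is at most 1. *)
  apply: (@le_trans _ _ (c / (1 - r) * r ^+ n * (1 - r ^+ k))); last first.
    by rewrite ler_piMr// ?lerBlDr ?lerDl ?exprn_ge0// mulr_ge0 ?exprn_ge0//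
      divr_ge0// ltW.
  elim: k => [|k IH]; first by rewrite addn0 mdistxx expr0 subrr mulr0.
  rewrite addnS; apply: le_trans (metric_triangle _ (s (n + k)%N) _) _.
  apply: le_trans (lerD IH (sP _)) _.
  rewrite exprD exprS le_eqVlt; apply/orP; left; apply/eqP.
  by field; rewrite gt_eqF.
have : cauchy (s @ \oo).
  apply: cauchy_exP => e e0.
  have [n hn] := geometric_lt (c / (1 - r)) rP e0.
  exists (s n); exists n => // k /= nk; rewrite -(subnKC nk) ballEmdist /=.
  exact: le_lt_trans (sn _ _) hn.
move=> /cauchy_cvg /cvg_ex[l sl]; exists l => n.
apply/ler_addgt0Pr => e e0.
have [N _ hN] := metricType_numDomainType.cvgr_dist_lt sl e0.
have := hN (n + N)%N (leq_addl _ _) => /= /ltW; rewrite metric_sym => h.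
by apply: le_trans (metric_triangle _ (s (n + N)%N) _) _; apply: lerD.
Qed.

Lemma contraction_fixed_point (R : realType) (T : completeMetricType R)
    (phi : T -> T) (r : R) : 0 <= r < 1 ->
  (forall x y, mdist (phi x) (phi y) <= r * mdist x y) -> exists x, x = phi x.
Proof.
move=> rP phir; have /andP[r0 r1] := rP.
pose s n := iter n phi point.
have sP n : mdist (s n) (s n.+1) <= mdist (s 0) (s 1) * r ^+ n.
  elim: n => [|n IH]; first by rewrite expr0 mulr1.
  by apply: le_trans (phir _ _) _; rewrite exprS mulrCA ler_wpM2l.
have [l hl] := geometric_complete (mdist_ge0 _ _) rP sP.
exists l; apply: mdist_positivity; apply/eqP; rewrite eq_le mdist_ge0 andbT.
set c := _ / _ in hl; apply: (@le_geometric _ _ _ (r * c + r * c) r) => // n.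
rewrite add0r; apply: le_trans (metric_triangle _ (s n.+1) _) _.
rewrite mulrDl; apply: lerD.
  by rewrite metric_sym; apply: le_trans (hl _) _; rewrite exprS mulrCA mulrA.
by apply: le_trans (phir _ _) _; rewrite -mulrA ler_wpM2l.
Qed.

(** * Boundedness of a coupled recursion *)

Section bounded_recursion.
Variables (R : realType) (r C Q l0 l1 p0 : R).
Hypotheses (rP : 0 <= r < 1) (C0 : 0 <= C) (Q0 : 0 <= Q) (l00 : 0 <= l0)
  (l10 : 0 <= l1) (p00 : 0 <= p0).

(* With K = (coupled n).1 and p = (coupled n).2: K bounds the distance, in units
   of eta, of the n-th iterate of the graph transform to the section i, and
   r ^ n * p that of two consecutive iterates.  The two bounds depend on each
   other. *)
Fixpoint coupled (n : nat) : R * R :=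
  if n is n'.+1 then
    ((coupled n').1 + C * r ^+ n' * (coupled n').2,
     r * ((coupled n').2 + Q * (l0 + l1 * (coupled n').1)))
  else (0, p0).

Lemma coupled_ge0 n : 0 <= (coupled n).1 /\ 0 <= (coupled n).2.
Proof.
have /andP[r0 _] := rP; elim: n => [|n [h1 h2]] //=.
by split; rewrite ?(addr_ge0, mulr_ge0, exprn_ge0).
Qed.

(** Since [1 + t <= expR t], the product of the growth factors is at most the exponential of a
    geometric sum, so it stays bounded although every factor is at least 1. *)
Lemma growth_bounded (E : nat -> R) (d : R) : 0 <= d -> 0 <= E 0%N ->
  (forall n, E n.+1 <= (1 + d * r ^+ n) * E n) ->
  forall n, E n <= E 0%N * expR (d / (1 - r)).
Proof.
move=> d0 E0 EP n; have /andP[r0 r1] := rP.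
have r1' : 0 < 1 - r by rewrite subr_gt0.
have En : E n <= E 0%N * expR (d * (1 - r ^+ n) / (1 - r)).
  elim: n => [|n IH]; first by rewrite expr0 subrr mulr0 mul0r expR0 mulr1.
  apply: le_trans (EP n) _.
  have h : 1 + d * r ^+ n <= expR (d * r ^+ n) by exact: expR_ge1Dx.
  have h0 : 0 <= 1 + d * r ^+ n by rewrite addr_ge0// mulr_ge0// exprn_ge0.
  apply: le_trans (ler_wpM2l h0 IH) _.
  rewrite mulrCA ler_wpM2l//; apply: le_trans (ler_wpM2r (expR_ge0 _) h) _.
  rewrite -expRD ler_expR exprS le_eqVlt; apply/orP; left; apply/eqP.
  by field; rewrite gt_eqF.
apply: le_trans En _; rewrite ler_wpM2l// ler_expR ler_pM2r ?invr_gt0//.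
by rewrite ler_piMr// lerBlDr lerDl exprn_ge0.
Qed.

Lemma coupled_bounded :
  exists2 S, 0 <= S & forall n, (coupled n).1 <= S /\ (coupled n).2 <= S.
Proof.
have /andP[r0 r1] := rP; have r1' : 0 < 1 - r by rewrite subr_gt0.
pose a := C / (1 - r); have a0 : 0 <= a by rewrite divr_ge0// ltW.
have aE : C + a * r = a by rewrite /a; field; rewrite gt_eqF.
clearbody a.
(* C + a * r = a makes the third term absorb the increment of the first one. *)
pose E n := 1 + (coupled n).1 + a * r ^+ n * (coupled n).2.
(* [d] is the coefficient of the rest of the increment. The summand 1 in [E] is there so that the
   constant [l0] too is bounded by a multiple of [E]. *)
pose d := a * Q * (l0 + l1).
have d0 : 0 <= d by exact: mulr_ge0 (mulr_ge0 a0 Q0) (addr_ge0 l00 l10).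
have E00 : 0 <= E 0%N.
  rewrite /E /= addr0 expr0 mulr1; exact: addr_ge0 ler01 (mulr_ge0 a0 p00).
have EP n : E n.+1 <= (1 + d * r ^+ n) * E n.
  have [K0 P0] := coupled_ge0 n; rewrite /E /=.
  set K := (coupled n).1 in K0 *; set p := (coupled n).2 in P0 *.
  have rn : 0 <= r ^+ n by rewrite exprn_ge0.
  rewrite exprS; set t := r ^+ n in rn *.
  have -> : 1 + (K + C * t * p) + a * (r * t) * (r * (p + Q * (l0 + l1 * K))) =
     1 + K + t * p * (C + (a * r) * r) + a * (r * r) * t * Q * (l0 + l1 * K).
    by ring.
  have h1 : C + (a * r) * r <= a.
    have := ler_piMr (mulr_ge0 a0 r0) (ltW r1); lra.
  have rr1 : r * r <= 1 by apply: mulr_ile1; rewrite // ltW.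
  have h2 : a * (r * r) * t * Q * (l0 + l1 * K) <= d * t * (1 + K).
    rewrite /d; have -> : a * Q * (l0 + l1) * t * (1 + K) =
       (a * t * Q) * ((l0 + l1) * (1 + K)) by ring.
    have -> : a * (r * r) * t * Q * (l0 + l1 * K) =
       (a * t * Q) * (r * r * (l0 + l1 * K)) by ring.
    apply: ler_wpM2l; first by rewrite !mulr_ge0.
    apply: (@le_trans _ _ (l0 + l1 * K)).
      by rewrite ler_piMl// addr_ge0// mulr_ge0.
    have := mulr_ge0 l00 K0; have := l10; have := l00; lra.
  rewrite -addrA; apply: le_trans (lerD (lexx (1 + K)) (lerD _ h2)) _.
    by apply: ler_wpM2l h1; rewrite mulr_ge0.
  have := mulr_ge0 (mulr_ge0 d0 rn) (mulr_ge0 (mulr_ge0 a0 rn) P0).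
  nra.
have Eb := growth_bounded d0 E00 EP; set S1 := _ * expR _ in Eb.
have KS n : (coupled n).1 <= S1.
  have [K0 P0] := coupled_ge0 n; apply: le_trans (Eb n).
  have : 0 <= a * r ^+ n * (coupled n).2 by rewrite !mulr_ge0// exprn_ge0.
  rewrite /E; lra.
have S10 : 0 <= S1 := KS 0%N.
pose L := Q * (l0 + l1 * S1).
have L0 : 0 <= L by rewrite mulr_ge0// addr_ge0// mulr_ge0.
(* Once the first component is bounded, the second obeys [p' <= r * (p + L)]; [S2] is above [p0] and
   satisfies [r * (S2 + L) <= S2]. *)
pose S2 := p0 + L / (1 - r).
have LS : 0 <= L / (1 - r) by rewrite divr_ge0// ltW.
have PS n : (coupled n).2 <= S2.
  elim: n => [|n IH] /=; first by rewrite lerDl.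
  have hL : Q * (l0 + l1 * (coupled n).1) <= L.
    by rewrite ler_wpM2l// lerD2l ler_wpM2l.
  apply: (@le_trans _ _ (r * (S2 + L))); first by rewrite ler_wpM2l// lerD.
  rewrite -subr_ge0.
  have -> : S2 - r * (S2 + L) = (1 - r) * p0 + (1 - r) * L.
    by rewrite /S2; field; rewrite gt_eqF.
  by rewrite addr_ge0// mulr_ge0// ltW.
exists (S1 + S2) => [|n]; first by rewrite addr_ge0// /S2 addr_ge0.
split; first by apply: le_trans (KS n) _; rewrite lerDl /S2 addr_ge0.
by apply: le_trans (PS n) _; rewrite lerDr.
Qed.

End bounded_recursion.

(** * The graph transform and the comparison of its iterates *)

Section graph_transform.
Variables (R : realType) (M : Type) (X Y : M -> completeMetricType R).
Variables (u : M -> M).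
Variables (F : forall m, X m -> Y (u m) -> X (u m)).
Variables (G : forall m, X m -> Y (u m) -> Y m).
(** Common constants for both alternatives: [b] is beta' and [ls] is lambda_s; [a] is alpha under
    (ii) and alpha' under (ii)'. *)
Variables (a b ls kappa : M -> R) (A B delta theta : R).
Hypotheses (a_ge0 : forall m, 0 <= a m) (b_ge0 : forall m, 0 <= b m).
Hypotheses (ls_ge0 : forall m, 0 <= ls m) (kappa_ge0 : forall m, 0 <= kappa m).
Hypotheses (a_le : forall m, a m <= A) (b_le : forall m, b (u m) <= B).
Hypotheses (A_ge0 : 0 <= A) (B_ge0 : 0 <= B).
Hypotheses (delta_gt0 : 0 < delta).
Hypothesis ab_le : forall m, a m * b (u m) <= 1 - delta.
Hypothesis F_lip : forall m (x : X m) y y',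
  mdist (F x y) (F x y') <= a m * mdist y y'.
Hypothesis G_lip : forall m (x : X m) y y',
  mdist (G x y) (G x y') <= kappa m * mdist y y'.
Hypothesis cone : forall m (x x' : X m) y y',
  mdist y y' <= b (u m) * mdist (F x y) (F x' y') ->
  mdist (G x y) (G x' y') <= b m * mdist x x' /\
  mdist (F x y) (F x' y') <= ls m * mdist x x'.

Implicit Types g f : forall m, X m -> Y m.

Definition lip_b g := forall m (x x' : X m),
  mdist (g m x) (g m x') <= b m * mdist x x'.

(** The default [point] is returned only if the equation has no solution, which does not happen when
    [lip_b g]. *)
Definition next g m (x : X m) : X (u m) :=
  xget point [set x2 | x2 = F x (g (u m) x2)].

Definition transform g m (x : X m) : Y m := G x (g (u m) (next g x)).

(** Go through [g (u m) x1]: one leg is vertical, the other runs along the graph of [g] and is at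
    most [a m * b (u m)] times the whole distance. *)
Lemma vertical_distance_le f g m (x1 x1' : X (u m)) : lip_b g ->
  mdist x1 x1' <= a m * mdist (f (u m) x1) (g (u m) x1') ->
  (1 - a m * b (u m)) * mdist (f (u m) x1) (g (u m) x1') <=
    mdist (f (u m) x1) (g (u m) x1).
Proof.
move=> gb h.
have h1 := metric_triangle (f (u m) x1) (g (u m) x1) (g (u m) x1').
have h2 := gb (u m) x1 x1'; have h3 := ler_wpM2l (b_ge0 (u m)) h.
lra.
Qed.

Lemma nextE g m (x : X m) : lip_b g -> next g x = F x (g (u m) (next g x)).
Proof.
move=> gb; have m0 : 0 <= 1 - delta < 1.
  by rewrite gtrBl delta_gt0 andbT (le_trans _ (ab_le m))// mulr_ge0.
suff [x2 x2E] : exists x2, x2 = F x (g (u m) x2).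
  by apply: (@xgetPex _ point [set x2 | x2 = F x (g (u m) x2)]); exists x2.
apply: (contraction_fixed_point m0) => x2 x2'; apply: le_trans (F_lip _ _ _) _.
apply: le_trans (ler_wpM2l (a_ge0 m) (gb _ _ _)) _.
by rewrite mulrA ler_wpM2r// mdist_ge0.
Qed.

Lemma next_unique g m (x : X m) x2 : lip_b g ->
  x2 = F x (g (u m) x2) -> x2 = next g x.
Proof.
move=> gb x2E; apply: mdist_positivity; apply/eqP.
rewrite eq_le mdist_ge0 andbT.
have := F_lip x (g (u m) x2) (g (u m) (next g x)).
rewrite -x2E -nextE// => h1.
have h2 := ler_wpM2l (a_ge0 m) (gb _ x2 (next g x)).
have := ler_wpM2r (mdist_ge0 x2 (next g x)) (ab_le m); move: h1 h2.
set d := mdist _ _; set e := mdist _ _ => h1 h2 h3.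
rewrite -(pmulr_rle0 _ delta_gt0); lra.
Qed.

(** Both image points lie on the graph of [g] over [u m], so the premise of [cone] is the Lipschitz
    bound of [g] there. *)
Lemma next_cone g m (x x' : X m) : lip_b g ->
  mdist (transform g x) (transform g x') <= b m * mdist x x' /\
  mdist (next g x) (next g x') <= ls m * mdist x x'.
Proof.
move=> gb; rewrite [next g x]nextE// [next g x']nextE//.
by apply: cone; rewrite -!nextE.
Qed.

Lemma lip_b_iter g n : lip_b g -> lip_b (iter n transform g).
Proof.
by move=> gb; elim: n => //= n IH m x x'; have [] := next_cone x x' IH.
Qed.

Lemma next_diff f g m (x : X m) : lip_b f -> lip_b g ->
  mdist (next f x) (next g x) <=
    a m * mdist (f (u m) (next f x)) (g (u m) (next g x)).
Proof.
by move=> fb gb; rewrite {1}[next f x]nextE// {1}[next g x]nextE.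
Qed.

(** The orbit is that of [f] alone. Its steps use the iterates n-1, ..., 0 in this order, because
    the n-th iterate at [x] is computed from the preceding one at the next point. *)
Fixpoint orbit_diff n f g m (x : X m) : R :=
  if n is n'.+1 then
    kappa m * orbit_diff n' f g (next (iter n' transform f) x)
  else mdist (f m x) (g m x).

(** Moving the comparison to a common base point costs the factor [1 / (1 - a m * b (u m))] at every
    step; the Lipschitz constant assumed for [G] makes up for exactly this factor. *)
Lemma transform_diff_lip :
  (forall m (x : X m) y y',
    mdist (G x y) (G x y') <= kappa m * (1 - a m * b (u m)) * mdist y y') ->
  forall n f g m (x : X m), lip_b f -> lip_b g ->
  mdist (iter n transform f m x) (iter n transform g m x) <= orbit_diff n f g x.
Proof.
move=> G_lip' n f g m x fb gb; elim: n m x => [|n IH] m x //=.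
apply: le_trans (G_lip' _ _ _ _) _; rewrite -mulrA ler_wpM2l//.
have fnb := lip_b_iter n fb; have gnb := lip_b_iter n gb.
apply: le_trans (IH _ _).
apply: (@vertical_distance_le (iter n transform f)) => //.
exact: next_diff.
Qed.

(* The cone condition is applied along the two orbits up to time n, and the
   vertical distance is compared with the distance of the points of the orbits
   only once, at the end: the factor 1 / delta is not iterated. *)
Lemma transform_diff_cone (alpha : M -> R) :
  (forall m, a m <= alpha (u m)) ->
  (forall m (x x' : X m) y y',
    mdist x x' <= alpha m * mdist (G x y) (G x' y') ->
    mdist (F x y) (F x' y') <= a m * mdist y y' /\
    mdist (G x y) (G x' y') <= kappa m * mdist y y') ->
  forall n f g m (x : X m), lip_b f -> lip_b g ->
  mdist (iter n transform f m x) (iter n transform g m x) <=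
    delta^-1 * orbit_diff n f g x.
Proof.
move=> a_alpha coneA n f g m x fb gb.
(* The base points must be allowed to differ, since the two orbits separate after one step. The
   premise is the cone that [coneA] reproduces at the next points. *)
have claim k m' (x1 x1' : X (u m')) :
    mdist x1 x1' <= a m' *
      mdist (iter k transform f (u m') x1) (iter k transform g (u m') x1') ->
    mdist (iter k transform f (u m') x1) (iter k transform g (u m') x1') <=
      delta^-1 * orbit_diff k f g x1.
  elim: k m' x1 x1' => [|k IH] m' x1 x1' /= h.
    rewrite mulrC ler_pdivlMr// mulrC.
    apply: le_trans (vertical_distance_le gb h); rewrite ler_wpM2r ?mdist_ge0//.
    by have := ab_le m'; lra.
  have fkb := lip_b_iter k fb; have gkb := lip_b_iter k gb.
  have [h1 h2] := coneA _ _ _ _ _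
    (le_trans h (ler_wpM2r (mdist_ge0 _ _) (a_alpha m'))).
  rewrite -!nextE// in h1.
  apply: le_trans h2 _; rewrite mulrCA ler_wpM2l//.
  exact: IH h1.
have d1 : 1 <= delta^-1.
  rewrite invf_ge1//; have := ab_le m.
  by have := mulr_ge0 (a_ge0 m) (b_ge0 (u m)); lra.
case: n => [|n] /=; first by rewrite ler_peMl// mdist_ge0.
apply: le_trans (G_lip _ _ _) _; rewrite mulrCA ler_wpM2l//.
by apply: claim; apply: next_diff; exact: lip_b_iter.
Qed.

(** * Estimates near the section, and fixed points of the transform *)

Section near_section.
Variables (i : forall m, X m * Y m) (eta eps1 : M -> R) (rho C0 : R).
Hypotheses (eta_ge0 : forall m, 0 <= eta m).
Hypothesis i_X : forall m,
  mdist (i (u m)).1 (F (i m).1 (i (u m)).2) <= eta (u m).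
Hypothesis i_Y : forall m, mdist (i m).2 (G (i m).1 (i (u m)).2) <= eta m.
Hypothesis eta_u : forall m, eta (u m) <= eps1 m * eta m.
Hypothesis ls_kappa : forall m, kappa m * ls m <= theta.
Hypothesis eps_kappa : forall m, kappa m * eps1 m <= theta.
Hypotheses (rhoP : 0 <= rho < 1) (theta_rho : theta <= rho * rho).
Hypothesis C0_ge0 : 0 <= C0.
Hypothesis transform_diff : forall n f g m (x : X m), lip_b f -> lip_b g ->
  mdist (iter n transform f m x) (iter n transform g m x) <=
    C0 * orbit_diff n f g x.

Definition near_i K g := forall m, mdist (g m (i m).1) (i m).2 <= K * eta m.

Let A' := A / delta.

Let A'_ge0 : 0 <= A'. Proof. by rewrite divr_ge0// ltW. Qed.

Lemma kappa_eta m : kappa m * eta (u m) <= theta * eta m.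
Proof.
apply: le_trans (ler_wpM2l (kappa_ge0 m) (eta_u m)) _.
by rewrite mulrA ler_wpM2r.
Qed.

(** The horizontal and the vertical distance to the section bound each other; eliminating one
    divides by [1 - a m * b (u m) >= delta]. *)
Lemma next_near_i K g m : 0 <= K -> lip_b g -> near_i K g ->
  mdist (g (u m) (next g (i m).1)) (i (u m)).2 <= (K + B) / delta * eta (u m) /\
  mdist (next g (i m).1) (i (u m)).1 <= (1 + A' * (K + B)) * eta (u m).
Proof.
move=> K0 gb gi.
set x2 := next g (i m).1; set y2 := g (u m) x2.
set e := mdist y2 _; set d := mdist x2 _.
have hd : d <= eta (u m) + a m * e.
  apply: le_trans (metric_triangle _ (F (i m).1 (i (u m)).2) _) _.
  rewrite addrC [X in X + _]metric_sym; apply: lerD; first exact: i_X.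
  by rewrite {1}/x2 nextE.
have he : e <= K * eta (u m) + b (u m) * d.
  apply: le_trans (metric_triangle _ (g (u m) (i (u m)).1) _) _.
  by rewrite addrC; apply: lerD; [exact: gi|exact: gb].
have e0 : 0 <= e := mdist_ge0 _ _.
have h1 := ler_wpM2l (b_ge0 (u m)) hd.
have h2 := ler_wpM2r e0 (ab_le m).
have h3 := ler_wpM2r (eta_ge0 (u m)) (b_le m).
have he' : e <= (K + B) / delta * eta (u m).
  by rewrite mulrAC ler_pdivlMr//; lra.
split => //; apply: le_trans hd _.
rewrite mulrDl mul1r lerD2l.
apply: le_trans (ler_wpM2r e0 (a_le m)) _.
apply: le_trans (ler_wpM2l A_ge0 he') _.
by rewrite le_eqVlt; apply/orP; left; apply/eqP; rewrite /A'; ring.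
Qed.

(** This serves for the first iterate only: [theta / delta] may exceed 1, so iterating the bound
    need not keep it bounded. Later iterates are controlled through [coupled]. *)
Lemma near_transform K g : 0 <= K -> lip_b g -> near_i K g ->
  near_i (1 + theta * ((K + B) / delta)) (transform g).
Proof.
move=> K0 gb gi m; have [h _] := next_near_i m K0 gb gi.
apply: le_trans (metric_triangle _ (G (i m).1 (i (u m)).2) _) _.
rewrite addrC [X in X + _]metric_sym mulrDl mul1r.
apply: lerD; first exact: i_Y.
apply: le_trans (G_lip _ _ _) _.
apply: le_trans (ler_wpM2l (kappa_ge0 m) h) _.
rewrite mulrCA [leRHS]mulrAC [leRHS]mulrC ler_wpM2l ?kappa_eta//.
by rewrite divr_ge0 ?addr_ge0// ltW.
Qed.

(** Each step gains [theta <= rho * rho]: one factor [rho] gives the decay [rho ^+ n], the other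
    goes into the recursion for [p], which collects the drift [L] of the orbit of the section. The
    weight [q] depends on [m] because [b] is bounded only on the image of [u]; at image points [Q]
    bounds it. *)
Lemma orbit_diff_le (q : M -> R) (Q : R) (p L : nat -> R) f g n :
  lip_b f -> 0 <= Q -> (forall m, q (u m) <= Q <= q m) ->
  (forall n, 0 <= p n) -> (forall n, 0 <= L n) ->
  (forall n, rho * (p n + Q * L n) <= p n.+1) ->
  (forall m (x : X m), mdist (f m x) (g m x) <=
     p 0%N * eta m + q m * mdist x (i m).1) ->
  (forall k, (k < n)%N -> forall m,
     mdist (next (iter k transform f) (i m).1) (i (u m)).1 <=
       L k * eta (u m)) ->
  forall m (x : X m),
    orbit_diff n f g x <= rho ^+ n * (p n * eta m + q m * mdist x (i m).1).
Proof.
move=> fb Q0 qQ p0 L0 pL fg; elim: n => [|n IH] hL m x.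
  by rewrite expr0 mul1r; exact: fg.
have /andP[r0 r1] := rhoP; have rn : 0 <= rho ^+ n by exact: exprn_ge0.
have {}IH := IH (fun k kn => hL k (ltnW kn)).
rewrite /=; set x2 := next _ x.
apply: le_trans (ler_wpM2l (kappa_ge0 m) (IH _ _)) _.
rewrite mulrCA exprSr -mulrA ler_wpM2l//.
have := qQ m => /andP[q1 q2]; have d0 := mdist_ge0 x (i m).1.
set d := mdist x _ in d0 *; have d20 := mdist_ge0 x2 (i (u m)).1.
have hd : mdist x2 (i (u m)).1 <= ls m * d + L n * eta (u m).
  apply: le_trans (metric_triangle _ (next (iter n transform f) (i m).1) _) _.
  apply: lerD; last exact: hL.
  by have [] := next_cone x (i m).1 (lip_b_iter n fb).
have h1 : q (u m) * mdist x2 (i (u m)).1 <= Q * (ls m * d + L n * eta (u m)).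
  by apply: le_trans (ler_wpM2r d20 q1) _; exact: ler_wpM2l.
apply: le_trans (ler_wpM2l (kappa_ge0 m) (lerD (lexx _) h1)) _.
have -> : kappa m * (p n * eta (u m) + Q * (ls m * d + L n * eta (u m))) =
  (p n + Q * L n) * (kappa m * eta (u m)) + Q * d * (kappa m * ls m) by ring.
have pQ : 0 <= p n + Q * L n by rewrite addr_ge0// mulr_ge0.
have Qd : 0 <= Q * d by rewrite mulr_ge0.
rewrite mulrDr; apply: lerD.
  apply: le_trans (ler_wpM2l pQ (kappa_eta m)) _.
  apply: le_trans (ler_wpM2l pQ (ler_wpM2r (eta_ge0 m) theta_rho)) _.
  have -> : (p n + Q * L n) * (rho * rho * eta m) =
    rho * (rho * (p n + Q * L n) * eta m) by ring.
  by rewrite ler_wpM2l// ler_wpM2r.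
apply: le_trans (ler_wpM2l Qd (ls_kappa m)) _.
apply: le_trans (ler_wpM2l Qd theta_rho) _.
rewrite mulrC -mulrA ler_wpM2l//.
apply: le_trans (ler_piMl Qd (ltW r1)) _.
by rewrite ler_wpM2r.
Qed.

Lemma invariant_unique Kf Kg f g : 0 <= Kf -> 0 <= Kg ->
  lip_b f -> lip_b g -> near_i Kf f -> near_i Kg g ->
  transform f = f -> transform g = g -> f = g.
Proof.
move=> Kf0 Kg0 fb gb fi gi fE gE.
have iterE h n : transform h = h -> iter n transform h = h.
  by move=> hE; elim: n => //= n ->.
have /andP[r0 r1] := rhoP; have r1' : 0 < 1 - rho by rewrite subr_gt0.
pose L := 1 + A' * (Kf + B).
have L0 : 0 <= L by rewrite addr_ge0// mulr_ge0// addr_ge0.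
(* Twice [B], because [f] and [g] each contribute a slope [b]. *)
pose Q := B *+ 2; have Q0 : 0 <= Q by rewrite mulrn_wge0.
(* [Kf + Kg] is the gap over the section; the last term yields [rho * (P + Q * L) <= P], so a
   constant sequence [p] is admissible in [orbit_diff_le]. *)
pose P := Kf + Kg + Q * L / (1 - rho).
have P0 : 0 <= P.
  by rewrite addr_ge0 ?addr_ge0// divr_ge0 ?mulr_ge0 ?(ltW r1').
pose q m := Num.max (b m) B *+ 2.
have qQ m : q (u m) <= Q <= q m.
  by rewrite /q /Q !lerMn2r /= (max_idPr (b_le m)) lexx le_max lexx orbT.
have PL : rho * (P + Q * L) <= P.
  rewrite -subr_ge0.
  have -> : P - rho * (P + Q * L) = (1 - rho) * (Kf + Kg + Q * L).
    by rewrite /P; field; rewrite gt_eqF.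
  by rewrite mulr_ge0 ?(ltW r1')// addr_ge0 ?addr_ge0// mulr_ge0.
have fg m (x : X m) :
    mdist (f m x) (g m x) <= P * eta m + q m * mdist x (i m).1.
  have d0 := mdist_ge0 x (i m).1.
  have h1 := metric_triangle (f m x) (f m (i m).1) (g m x).
  have h2 := metric_triangle (f m (i m).1) (i m).2 (g m x).
  have h3 := metric_triangle (i m).2 (g m (i m).1) (g m x).
  have h4 := fb m x (i m).1.
  have := gb m x (i m).1; rewrite metric_sym => h5.
  have h6 := fi m; have := gi m; rewrite metric_sym => h7.
  have bq : b m * mdist x (i m).1 <= Num.max (b m) B * mdist x (i m).1.
    by rewrite ler_wpM2r// le_max lexx.
  have QL : 0 <= Q * L / (1 - rho) * eta m.
    by rewrite mulr_ge0// divr_ge0 ?mulr_ge0 ?(ltW r1').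
  rewrite /P /q mulr2n; move: QL; set QLe := Q * L / _ => QL; lra.
have fx m (x : X m) : mdist (f m x) (g m x) <= 0.
  pose c := C0 * (P * eta m + q m * mdist x (i m).1).
  apply: (@le_geometric _ _ _ c rho) => // n.
  rewrite add0r -mulrA [_ * rho ^+ n]mulrC.
  have := transform_diff n x fb gb; rewrite !iterE// => /le_trans; apply.
  rewrite ler_wpM2l//; apply: (@orbit_diff_le q Q (fun=> P) (fun=> L)) => //.
  move=> k _ m'; rewrite iterE//.
  by have [] := next_near_i m' Kf0 fb fi.
apply: functional_extensionality_dep => m; apply: funext => x.
by apply: mdist_positivity; apply/eqP; rewrite eq_le fx mdist_ge0.
Qed.

(** Two bounds are proved in a loop: the gap between iterates n and n+1 needs the distance of the
    earlier iterates to the section, and that gap in turn bounds the distance for iterate n+1.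
    Strong induction closes the loop and [coupled_bounded] makes the constants uniform. *)
Lemma invariant_exists :
  exists f, [/\ lip_b f, transform f = f & exists2 K, 0 <= K & near_i K f].
Proof.
have /andP[r0 r1] := rhoP; have r1' : 0 < 1 - rho by rewrite subr_gt0.
pose f0 m (x : X m) := (i m).2.
have f0b : lip_b f0.
  by move=> m x x'; rewrite mdistxx mulr_ge0// mdist_ge0.
have f0i : near_i 0 f0 by move=> m; rewrite mdistxx mul0r.
have f1b : lip_b (transform f0) by exact: (lip_b_iter 1 f0b).
pose fn n := iter n transform f0.
have fnb n : lip_b (fn n) by exact: lip_b_iter.
(* The bound of [near_transform] for K = 0, with [rho * rho] instead of [theta] so that [p0] is
   visibly nonnegative. *)
pose p0 := 1 + rho * rho * (B / delta).
have p00 : 0 <= p0.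
  have Bd := divr_ge0 B_ge0 (ltW delta_gt0).
  exact: addr_ge0 ler01 (mulr_ge0 (mulr_ge0 r0 r0) Bd).
have f1i : near_i p0 (transform f0).
  move=> m; have := near_transform (lexx 0) f0b f0i m.
  rewrite add0r => /le_trans; apply.
  by rewrite ler_wpM2r// lerD2l ler_wpM2r// divr_ge0// ltW.
(* With these parameters [l0 + l1 * K] is the constant [1 + A' * (K + B)] of [next_near_i]. *)
pose kp := coupled rho C0 B (1 + A' * B) A' p0.
have l00 : 0 <= 1 + A' * B by rewrite addr_ge0// mulr_ge0.
have kp0 n : 0 <= (kp n).1 /\ 0 <= (kp n).2.
  exact: (coupled_ge0 rhoP C0_ge0 B_ge0 l00 A'_ge0 p00).
have [S S0 Sk] := coupled_bounded rhoP C0_ge0 B_ge0 l00 A'_ge0 p00.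
pose q m := Num.max (b m) B.
have qQ m : q (u m) <= B <= q m.
  by rewrite /q (max_idPr (b_le m)) lexx le_max lexx orbT.
pose L n := 1 + A' * B + A' * (kp n).1.
have L0 n : 0 <= L n by rewrite addr_ge0// mulr_ge0//; have [] := kp0 n.
have f01 m (x : X m) :
    mdist (f0 m x) (transform f0 x) <=
      (kp 0%N).2 * eta m + q m * mdist x (i m).1.
  apply: le_trans (metric_triangle _ (transform f0 (i m).1) _) _.
  rewrite [X in X + _]metric_sym; apply: lerD; first exact: f1i.
  rewrite metric_sym; apply: le_trans (f1b _ _ _) _.
  by rewrite ler_wpM2r ?mdist_ge0// le_max lexx.
have step n : (forall k, (k < n)%N -> near_i (kp k).1 (fn k)) ->
    forall m (x : X m), mdist (fn n m x) (fn n.+1 m x) <=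
      C0 * (rho ^+ n * ((kp n).2 * eta m + q m * mdist x (i m).1)).
  move=> hn m x; rewrite /fn iterSr.
  apply: le_trans (transform_diff n x f0b f1b) _; rewrite ler_wpM2l//.
  apply: (@orbit_diff_le q B (fun n => (kp n).2) L) => //.
    by move=> k; have [] := kp0 k.
  move=> k kn m'; have [K0 _] := kp0 k.
  have [_] := next_near_i m' K0 (fnb k) (hn k kn).
  by rewrite mulrDr [A' * _ + _]addrC addrA.
have fni n : near_i (kp n).1 (fn n).
  have [N] := ubnP n; elim: N n => // N IH [_|n]; first exact: f0i.
  rewrite ltnS => nN m.
  have hs := step n (fun k kn => IH k (ltn_trans kn nN)) m (i m).1.
  (* Over the section itself the [q] term vanishes, which leaves exactly the increment of the first
     component of [coupled]. *)
  rewrite mdistxx mulr0 addr0 in hs.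
  apply: le_trans (metric_triangle _ (fn n m (i m).1) _) _.
  rewrite [X in X + _]metric_sym.
  apply: le_trans (lerD hs (IH n nN m)) _.
  by rewrite /= -/kp mulrDl addrC !mulrA.
pose c m (x : X m) := C0 * (S * eta m + q m * mdist x (i m).1).
have q0 m : 0 <= q m by rewrite le_max b_ge0.
have c0 m (x : X m) : 0 <= c m x.
  by rewrite mulr_ge0// addr_ge0// mulr_ge0// mdist_ge0.
have fn_step n m (x : X m) : mdist (fn n m x) (fn n.+1 m x) <= c m x * rho ^+ n.
  apply: le_trans (step n (fun k _ => fni k) m x) _.
  rewrite /c mulrCA -[leRHS]mulrC ler_wpM2l ?exprn_ge0// ler_wpM2l//.
  by rewrite lerD2r ler_wpM2r//; have [] := Sk n.
pose c' m (x : X m) := c m x / (1 - rho).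
have lim m x : {y | forall n, mdist (fn n m x) y <= c' m x * rho ^+ n}.
  apply: cid.
  exact: geometric_complete (c0 m x) rhoP (fun n => fn_step n m x).
pose f m x := sval (lim m x).
have fE n m x : mdist (fn n m x) (f m x) <= c' m x * rho ^+ n.
  exact: (svalP (lim m x)).
have fb : lip_b f.
  move=> m x x'; apply: (@le_geometric _ _ _ (c' m x + c' m x') rho) => // n.
  apply: le_trans (metric_triangle _ (fn n m x) _) _.
  rewrite [X in X + _]metric_sym mulrDl addrCA; apply: lerD => //.
  apply: le_trans (metric_triangle _ (fn n m x') _) _; apply: lerD => //.
  exact: fnb.
exists f; split=> //.
- apply: functional_extensionality_dep => m; apply: funext => x.
  apply: mdist_positivity; apply/eqP; rewrite eq_le mdist_ge0 andbT.
  pose e := C0 * (kappa m * c' _ (next f x)) + c' m x * rho.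
  apply: (@le_geometric _ _ _ e rho) => // n; rewrite add0r.
  apply: le_trans (metric_triangle _ (fn n.+1 m x) _) _.
  rewrite mulrDl; apply: lerD; last first.
    by apply: le_trans (fE _ _ _) _; rewrite exprS mulrA.
  (* With [f] as first argument the comparison takes place at [next f x], which does not move with
     [n]; pointwise convergence there suffices. *)
  apply: le_trans (transform_diff 1 x fb (fnb n)) _.
  have := fE n _ (next f x); rewrite metric_sym => h.
  apply: le_trans (ler_wpM2l C0_ge0 (ler_wpM2l (kappa_ge0 m) h)) _.
  by rewrite !mulrA.
- exists S => // m; apply: (@le_geometric _ _ _ (c' m (i m).1) rho) => // n.
  apply: le_trans (metric_triangle _ (fn n m (i m).1) _) _.
  rewrite [X in X + _]metric_sym addrC; apply: lerD => //.
  apply: le_trans (fni n m) _; rewrite ler_wpM2r//.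
  by have [] := Sk n.
Qed.

End near_section.

(** * Fixed points of the transform and invariant graphs *)

Section invariant_bundle_map.
Variable H : forall m, correspondence (X m * Y m) (X (u m) * Y (u m)).
Hypothesis HFG : forall m, generating_map (H m) (@F m) (@G m).
Variables (i : forall m, X m * Y m) (eps1 : M -> R) (rho C0 : R).
Hypothesis ls_kappa : forall m, kappa m * ls m <= theta.
Hypothesis eps_kappa : forall m, kappa m * eps1 m <= theta.
Hypotheses (rhoP : 0 <= rho < 1) (theta_rho : theta <= rho * rho).
Hypothesis C0_ge0 : 0 <= C0.
Hypothesis transform_diff : forall n f g m (x : X m), lip_b f -> lip_b g ->
  mdist (iter n transform f m x) (iter n transform g m x) <=
    C0 * orbit_diff n f g x.

Lemma fixed_invariant (eta : M -> R) K f :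
  (forall m, 0 <= eta m) ->
  (forall m, mdist (i (u m)).1 (F (i m).1 (i (u m)).2) <= eta (u m)) ->
  0 <= K -> lip_b f -> near_i i eta K f -> transform f = f ->
  lipschitz_near_section i b eta f /\ invariant_graph H i ls eta f.
Proof.
move=> eta_ge0 i_X K0 fb fi fE.
have fH m (x : X m) :
    corr_image (H m) (x, f m x) (next f x, f (u m) (next f x)).
  by apply/HFG; split; [rewrite -[in LHS]fE|exact: nextE].
split; first by split => [m|]; [apply/LipP|exists K].
split=> [m [x y]|].
  move=> yE; rewrite -[y]/((x, y).2) yE.
  by exists (next f x, f (u m) (next f x)).
exists (fun m => @next f m), (1 + A / delta * (K + B)) => m; split => //.
  by apply/LipP => // x x'; have [] := next_cone x x' fb.
by have [] := next_near_i eta_ge0 i_X m K0 fb fi.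
Qed.

(** The base map supplied by invariance solves the equation defining [next], hence equals it by
    uniqueness of the solution. *)
Lemma invariant_fixed (eta : M -> R) f :
  lipschitz_near_section i b eta f -> invariant_graph H i ls eta f ->
  [/\ lip_b f, transform f = f & exists2 K, 0 <= K & near_i i eta K f].
Proof.
move=> [fl fi] [_ [xs [K0 xsP]]].
have fb : lip_b f by move=> m; apply/LipP.
split => //; apply: functional_extensionality_dep => m; apply: funext => x.
have [+ _ _] := xsP m; move=> /(_ x)/HFG[fE xE].
by rewrite fE /transform -(next_unique fb xE).
Qed.

(** [f] is built from [eta] before [eta'] is given. It is also near the section in units of any
    larger [eta'], and uniqueness is then proved for [eta']; this order gives (3). *)
Lemma invariant_bundle_map (eta : M -> R) :
  (forall m, 0 <= eta m) ->
  (forall m, mdist (i (u m)).1 (F (i m).1 (i (u m)).2) <= eta (u m)) ->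
  (forall m, mdist (i m).2 (G (i m).1 (i (u m)).2) <= eta m) ->
  (forall m, eta (u m) <= eps1 m * eta m) ->
  exists f, forall eta' : M -> R,
    (forall m, eta' (u m) <= eps1 m * eta' m) ->
    (forall m, eta m <= eta' m) ->
    unique (fun g : forall m, X m -> Y m =>
      lipschitz_near_section i b eta' g /\ invariant_graph H i ls eta' g) f.
Proof.
move=> eta_ge0 i_X i_Y eta_u.
have [f [fb fE [K K0 fi]]] := invariant_exists eta_ge0 i_X i_Y eta_u ls_kappa
  eps_kappa rhoP theta_rho C0_ge0 transform_diff.
exists f => eta' eta'_u eta_le.
have eta'_ge0 m : 0 <= eta' m by exact: le_trans (eta_le m).
have i_X' m : mdist (i (u m)).1 (F (i m).1 (i (u m)).2) <= eta' (u m).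
  exact: le_trans (eta_le _).
have fi' : near_i i eta' K f.
  by move=> m; apply: le_trans (fi m) _; rewrite ler_wpM2l.
split; first exact: fixed_invariant fi' fE.
move=> g [gl gH]; have [gb gE [Kg Kg0 gi]] := invariant_fixed gl gH.
exact: (invariant_unique eta'_ge0 i_X' eta'_u ls_kappa eps_kappa rhoP theta_rho
  C0_ge0 transform_diff K0 Kg0 fb gb fi' gi fE gE).
Qed.

End invariant_bundle_map.
End graph_transform.

(** * Choice of the constants under (ii) and (ii)' *)

Theorem theorem4p1 (R : realType) (M : Type) (X Y : M -> completeMetricType R)
    (u : M -> M)
    (H : forall m, correspondence (X m * Y m) (X (u m) * Y (u m)))
    (F : forall m, X m -> Y (u m) -> X (u m))
    (G : forall m, X m -> Y (u m) -> Y m)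
    (HFG : forall m, generating_map (H m) (F m) (G m))
    (eps1 : M -> R) (eps1_ge0 : forall m, 0 <= eps1 m)
    (* (i) *)
    (i : forall m, X m * Y m)
    (eta : M -> R) (eta_ge0 : forall m, 0 <= eta m)
    (i_X : forall m,
      mdist (i (u m)).1 (F m (i m).1 (i (u m)).2) <= eta (u m))
    (i_Y : forall m, mdist (i m).2 (G m (i m).1 (i (u m)).2) <= eta m)
    (eps : M -> R) (eps_bounds : forall m, 0 <= eps m <= eps1 m)
    (eta_u : forall m, eta (u m) <= eps m * eta m)
    (alpha beta beta' lambda_u lambda_s : M -> R)
    (alpha_ge0 : forall m, 0 <= alpha m)
    (beta_ge0 : forall m, 0 <= beta m)
    (beta'_ge0 : forall m, 0 <= beta' m)
    (lambda_u_ge0 : forall m, 0 <= lambda_u m)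
    (lambda_s_ge0 : forall m, 0 <= lambda_s m)
    (hyp :
      (* (ii) *)
      [/\ (forall m, condA' (F m) (G m) (alpha m) (lambda_u m)) /\
          (forall m, condB (H m) (beta m) (beta' m) (lambda_s m)),
          [/\ (esup (fun m => alpha m * beta' (u m))%R < 1)%E,
              forall m, beta' (u m) <= beta m
            & (esup (fun m => Num.max (alpha m) (beta m))%R < +oo)%E]
        & (esup (fun m => (lambda_u m * lambda_s m + lambda_u m * eps1 m)
                          / (1 - alpha m * beta' (u m)))%R < 1)%E]
      \/
      (* (ii)' *)
      (exists2 alpha' : M -> R, forall m, 0 <= alpha' m &
      [/\ (forall m, condA (H m) (alpha m) (alpha' m) (lambda_u m)) /\
          (forall m, condB (H m) (beta m) (beta' m) (lambda_s m)),
          [/\ (esup (fun m => alpha' m * beta' (u m))%R < 1)%E,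
              forall m, alpha' m <= alpha (u m),
              forall m, beta' (u m) <= beta m
            & (esup (fun m => Num.max (alpha m) (beta m))%R < +oo)%E]
        & (esup (fun m => lambda_s m * lambda_u m)%R < 1)%E /\
          (esup (fun m => lambda_u m * eps1 m)%R < 1)%E])) :
  exists f : forall m, X m -> Y m,
    (* (1), (2) and uniqueness *)
    unique (fun g : forall m, X m -> Y m =>
              lipschitz_near_section i beta' eta g /\
              invariant_graph H i lambda_s eta g) f /\
    (* (3) *)
    forall eta' eps' : M -> R,
      (forall m, 0 <= eta' m) ->
      (forall m, eta' (u m) <= eps' m * eta' m) ->
      (forall m, eps' m <= eps1 m) ->
      (forall m, eta m <= eta' m) ->
      unique (fun g : forall m, X m -> Y m =>
                lipschitz_near_section i beta' eta' g /\
                invariant_graph H i lambda_s eta' g) f.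
Proof.
have [HB bb] : (forall m, condB (H m) (beta m) (beta' m) (lambda_s m)) /\
    (forall m, beta' (u m) <= beta m).
  by case: hyp => [[[_ ?] [_ ? _] _]|[? _ [[_ ?] [_ _ ? _] _]]].
have cone m (x x' : X m) y y' :
    mdist y y' <= beta' (u m) * mdist (F m x y) (F m x' y') ->
    mdist (G m x y) (G m x' y') <= beta' m * mdist x x' /\
    mdist (F m x y) (F m x' y') <= lambda_s m * mdist x x'.
  move=> h; apply: (HB m _ _ _ _ _ _ y y'); [exact/HFG|exact/HFG|].
  by apply: le_trans h _; rewrite ler_wpM2r// mdist_ge0.
have unified (a kappa : M -> R) (A delta theta C0 : R) :
    (forall m, 0 <= a m) -> (forall m, 0 <= kappa m) ->
    (forall m, a m <= A) -> (forall m, beta' (u m) <= A) -> 0 <= A ->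
    0 < delta -> 0 <= theta < 1 -> 0 <= C0 ->
    (forall m, a m * beta' (u m) <= 1 - delta) ->
    (forall m x y y', mdist (F m x y) (F m x y') <= a m * mdist y y') ->
    (forall m x y y', mdist (G m x y) (G m x y') <= kappa m * mdist y y') ->
    (forall m, kappa m * lambda_s m <= theta) ->
    (forall m, kappa m * eps1 m <= theta) ->
    (forall n f g m (x : X m), lip_b beta' f -> lip_b beta' g ->
      mdist (iter n (transform F G) f m x) (iter n (transform F G) g m x) <=
        C0 * orbit_diff F G kappa n f g x) ->
    exists f : forall m, X m -> Y m, forall eta' : M -> R,
      (forall m, eta' (u m) <= eps1 m * eta' m) ->
      (forall m, eta m <= eta' m) ->
      unique (fun g : forall m, X m -> Y m =>
        lipschitz_near_section i beta' eta' g /\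
        invariant_graph H i lambda_s eta' g) f.
  move=> a0 k0 aA bA A0 d0 /andP[t0 t1] C00 ab FL GL lsk epsk diff.
  (* The mean of 1 and [theta] is below 1, and its square exceeds [theta] by [(1 - theta)^2 / 4]. *)
  have rhoP : 0 <= (1 + theta) / 2 < 1 by apply/andP; split; lra.
  have trho : theta <= (1 + theta) / 2 * ((1 + theta) / 2).
    have := sqr_ge0 (1 - theta); nra.
  apply: (invariant_bundle_map a0 beta'_ge0 lambda_s_ge0 k0 aA bA A0 A0 d0 ab FL
    GL cone HFG lsk epsk rhoP trho C00 diff eta_ge0 i_X i_Y) => m.
  apply: le_trans (eta_u m) _; rewrite ler_wpM2r//.
  by have /andP[] := eps_bounds m.
suff [f fP] : exists f : forall m, X m -> Y m, forall eta' : M -> R,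
      (forall m, eta' (u m) <= eps1 m * eta' m) ->
      (forall m, eta m <= eta' m) ->
      unique (fun g : forall m, X m -> Y m =>
        lipschitz_near_section i beta' eta' g /\
        invariant_graph H i lambda_s eta' g) f.
  exists f; split.
    apply: fP => // m; apply: le_trans (eta_u m) _; rewrite ler_wpM2r//.
    by have /andP[] := eps_bounds m.
  move=> eta' eps' eta'_ge0 eta'_u eps'_le eta_le; apply: fP => // m.
  by apply: le_trans (eta'_u m) _; rewrite ler_wpM2r.
case: hyp => [[[HA _] [ab_sup _ ab_fin] th_sup]|
    [alpha' alpha'_ge0 [[HA _] [ab_sup aa _ ab_fin] [th1_sup th2_sup]]]].
- have [s [s0 s1 ab]] := esup_bound ab_sup lte01.
  have [A [A0 _ maxA]] := esup_bound ab_fin (ltry 0).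
  have [theta [t0 t1 th]] := esup_bound th_sup lte01.
  rewrite !lte_fin in s1 t1.
  have aA m : alpha m <= A by apply: le_trans (maxA m); rewrite le_max lexx.
  have bA m : beta m <= A by apply: le_trans (maxA m); rewrite le_max lexx orbT.
  have ab1 m : 0 < 1 - alpha m * beta' (u m).
    by rewrite subr_gt0 (le_lt_trans (ab m)).
  pose kappa m := lambda_u m / (1 - alpha m * beta' (u m)).
  have k0 m : 0 <= kappa m by rewrite divr_ge0// ltW.
  have kE m : kappa m * (1 - alpha m * beta' (u m)) = lambda_u m.
    by rewrite /kappa divfK// gt_eqF.
  have FL m x y y' : mdist (F m x y) (F m x y') <= alpha m * mdist y y'.
    move: y y'; apply/LipP => //; have [h _] := HA m; apply: le_trans h.
    by apply: ereal_sup_ubound; exists x.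
  have GL m x y y' : mdist (G m x y) (G m x y') <= lambda_u m * mdist y y'.
    move: y y'; apply/LipP => //; have [_ h] := HA m; apply: le_trans h.
    by apply: ereal_sup_ubound; exists x.
  have GL' m x y y' : mdist (G m x y) (G m x y') <= kappa m * mdist y y'.
    apply: le_trans (GL _ _ _ _) _; rewrite ler_wpM2r ?mdist_ge0// -kE.
    by rewrite ler_piMr// lerBlDr lerDl mulr_ge0.
  have d0 : 0 < 1 - s by rewrite subr_gt0.
  have ab' m : alpha m * beta' (u m) <= 1 - (1 - s).
    by rewrite opprB addrC subrK.
  have kth m : kappa m * lambda_s m + kappa m * eps1 m <= theta.
    by apply: le_trans (th m); rewrite /kappa mulrDl ![_ / _ * _]mulrAC.
  apply: (unified alpha kappa A (1 - s) theta 1) => //.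
  + by move=> m; exact: le_trans (bA m).
  + by rewrite t0.
  + by move=> m; apply: le_trans (kth m); rewrite lerDl mulr_ge0.
  + by move=> m; apply: le_trans (kth m); rewrite lerDr mulr_ge0.
  + move=> n f g m x fb gb; rewrite mul1r.
    apply: (transform_diff_lip alpha_ge0 beta'_ge0 k0 d0 ab' FL cone) => //.
    by move=> m' x' y y'; rewrite kE.
- have [s [s0 s1 ab]] := esup_bound ab_sup lte01.
  have [A [A0 _ maxA]] := esup_bound ab_fin (ltry 0).
  have [t1 [t10 t11 th1]] := esup_bound th1_sup lte01.
  have [t2 [t20 t21 th2]] := esup_bound th2_sup lte01.
  rewrite !lte_fin in s1 t11 t21.
  have aA m : alpha m <= A by apply: le_trans (maxA m); rewrite le_max lexx.
  have bA m : beta m <= A by apply: le_trans (maxA m); rewrite le_max lexx orbT.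
  have coneA m (x x' : X m) y y' :
      mdist x x' <= alpha m * mdist (G m x y) (G m x' y') ->
      mdist (F m x y) (F m x' y') <= alpha' m * mdist y y' /\
      mdist (G m x y) (G m x' y') <= lambda_u m * mdist y y'.
    by apply: HA; exact/HFG.
  (* Points over the same [x] satisfy the premise of (A) trivially, so (A) contains Lipschitz bounds
     in the second variable. *)
  have FGL m x y y' :
      mdist (F m x y) (F m x y') <= alpha' m * mdist y y' /\
      mdist (G m x y) (G m x y') <= lambda_u m * mdist y y'.
    by apply: coneA; rewrite mdistxx mulr_ge0// mdist_ge0.
  have FL m x y y' := proj1 (FGL m x y y').
  have GL m x y y' := proj2 (FGL m x y y').
  have d0 : 0 < 1 - s by rewrite subr_gt0.
  have ab' m : alpha' m * beta' (u m) <= 1 - (1 - s).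
    by rewrite opprB addrC subrK.
  (* The last constant is the factor [delta^-1] of [transform_diff_cone], with [delta = 1 - s]. *)
  apply: (unified alpha' lambda_u A (1 - s) (Num.max t1 t2) (1 - s)^-1) => //.
  + by move=> m; exact: le_trans (aA _).
  + by move=> m; exact: le_trans (bA m).
  + by rewrite le_max t10 /= gt_max t11.
  + by rewrite invr_ge0 ltW.
  + by move=> m; rewrite mulrC; apply: le_trans (th1 m) _; rewrite le_max lexx.
  + by move=> m; apply: le_trans (th2 m) _; rewrite le_max lexx orbT.
  + move=> n f g m x fb gb.
    exact: (transform_diff_cone alpha'_ge0 beta'_ge0 lambda_u_ge0 d0 ab' FL GL
      cone aa coneA).
Qed.
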